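(* Let $G=(\mathcal{V},\mathcal{E})$ be a finite undirected connected simple graph with $m$ edges, consider the simple random walk on $G$, and let $f:\mathcal{E}\to\mathbb{R}$ be a nonnegative edge-cost function. Then for any vertices $x,y\in\mathcal{V}$, $$\mathcal{H}^f(x,y)\leqslant\sum_{e\in\mathcal{E}}\bigl(2\,\mathrm{d}_y(e)+1\bigr)f(e)\leqslant m^2\max_{e\in\mathcal{E}} f(e).$$
   Context: The simple random walk moves from a vertex $x$ to each neighbor with probability $1/\deg(x)$. The cost of a finite walk is the sum of $f(e)$ over its traversed edges with multiplicity; $\mathcal{H}^f(x,y)$ is the expected cost of the walk started at $x$ and stopped upon first reaching $y$. $\mathrm{d}_y(e)$ is the minimum of the graph distances from $y$ to the two endpoints of $e$. *)

(* Defs.v *)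
From HB Require Import structures.
From mathcomp Require Import all_boot all_order all_algebra.
From mathcomp Require Import all_classical all_reals all_analysis.

Set Implicit Arguments.
Unset Strict Implicit.
Unset Printing Implicit Defensive.

Import Order.TTheory GRing.Theory Num.Theory.

Local Open Scope classical_set_scope.
Local Open Scope ring_scope.

Section Graph.
Variables (T : finType) (adj : rel T).

Definition connected_simple_graph : Prop :=
  [/\ symmetric adj, irreflexive adj & forall u v : T, connect adj u v].

Definition edges : {set {set T}} :=
  [set [set p.1; p.2]%SET | p in [pred p : T * T | adj p.1 p.2]]%SET.

Definition deg (u : T) : nat := #|[set v | adj u v]%SET|.

Definition has_walk (u v : T) (n : nat) : bool :=
  [exists p : n.-tuple T, path adj u p && (last u p == v)].

(* Least length of a walk from u to v. A shortest walk has fewer than #|T|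
   steps, so this is the graph distance whenever u and v are connected
   (and #|T| otherwise). *)
Definition gdist (u v : T) : nat := find (has_walk u v) (iota 0 #|T|).

(* The initial value #|T| bounds every distance, hence is never the minimum
   over the endpoints of an edge of a connected graph. *)
Definition edge_dist (y : T) (a : {set T}) : nat :=
  \big[minn/#|T|]_(u in a) gdist y u.

End Graph.

Section RandomWalk.
Variables (R : realType) (T : finType) (adj : rel T).

(* An isolated vertex (which in a connected graph is the only vertex) is made
   absorbing, so that the walk is defined on the one-vertex graph too. *)
Definition step_prob (u v : T) : R :=
  if deg adj u == 0%N then (u == v)%:R
  else if adj u v then (deg adj u)%:R^-1 else 0.

Variables (d : measure_display) (Omega : measurableType d).

Definition history (X : nat -> Omega -> T) (w : nat -> T) (n : nat)
  : set Omega := [set o | forall i, (i <= n)%N -> X i o = w i].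

(* Markov property in product form: conditionally on any history of positive
   probability ending at w n, the next position is v with probability
   step_prob (w n) v. *)
Definition simple_random_walk (P : probability Omega R)
    (X : nat -> Omega -> T) (x : T) : Prop :=
  [/\ forall n v, measurable (X n @^-1` [set v]),
      P (X 0%N @^-1` [set x]) = 1%E
    & forall (w : nat -> T) (n : nat) (v : T),
        P (history X w n `&` X n.+1 @^-1` [set v])
        = (P (history X w n) * (step_prob (w n) v)%:E)%E].

(* The n-th step is performed before the walk is stopped iff none of the
   positions at times 0, ..., n is y. *)
Definition stopped_cost (f : {set T} -> R) (X : nat -> Omega -> T) (y : T)
    (o : Omega) : \bar R :=
  (\sum_(0 <= n <oo)
     (if [forall k : 'I_n.+1, X k o != y] && adj (X n o) (X n.+1 o)
      then f [set X n o; X n.+1 o]%SET else 0)%:E)%E.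

Definition hitting_cost (P : probability Omega R) (X : nat -> Omega -> T)
    (f : {set T} -> R) (y : T) : \bar R :=
  (\int[P]_o stopped_cost f X y o)%E.

End RandomWalk.

(* Main.v *)
Require Import Defs.
From HB Require Import structures.
From mathcomp Require Import all_boot all_order all_algebra.
From mathcomp Require Import all_classical all_reals all_analysis.
From mathcomp Require Import measurable_realfun zify lra.

(** Let [g u] be [1 / deg u] times the expected number of visits to [u], among
    the first [N] steps, before the walk hits [y].  The expected truncated cost
    is the sum over the edges [{u, v}] of [(g u + g v) f {u, v}].  The increments
    of [g] form a flow towards [y] whose sources have total strength at most one
    (truncation at [N] only helps, as [g] increases with [N]), so comparing with
    the cut around a superlevel set shows that [g] drops by at most one along an
    edge.  Hence [g u] is at most the distance from [y] to [u], and
    [g u + g v <= 2 d_y(e) + 1] for [e = {u, v}]; monotone convergence removes the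
    truncation.  For the second bound, an edge at distance [k] from [y] comes with
    edges at all distances below [k], so [d_y(e)] is at most the number of edges
    strictly closer to [y] than [e]. *)

Set Implicit Arguments.
Unset Strict Implicit.
Unset Printing Implicit Defensive.

Import Order.TTheory GRing.Theory Num.Theory.

Local Open Scope ring_scope.

(** * Distances from a vertex to vertices and to edges *)

Section GraphDistance.
Variables (T : finType) (adj : rel T).
Hypothesis hG : connected_simple_graph adj.

Lemma has_walkP (u v : T) (n : nat) :
  reflect (exists p, [/\ size p = n, path adj u p & last u p = v])
          (has_walk adj u v n).
Proof.
apply: (iffP existsP) => [[p /andP[pp /eqP pl]]|[p [/eqP sp pp pl]]].
  by exists p; rewrite size_tuple.
by exists (Tuple sp); rewrite /= pp pl eqxx.
Qed.

Lemma gdist_le (u v : T) (n : nat) : has_walk adj u v n -> (gdist adj u v <= n)%N.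
Proof.
move=> h; rewrite /gdist leqNgt; apply/negP => lt.
have := before_find 0 lt; rewrite nth_iota ?add0n ?h //.
by apply: leq_trans lt _; rewrite -[leqRHS](size_iota 0) find_size.
Qed.

(** Shortening a walk to one without repeated vertices leaves fewer than [#|T|] steps. So the search
    in [gdist] succeeds on a connected graph. *)
Lemma gdist_lt_card (u v : T) : (gdist adj u v < #|T|)%N.
Proof.
have [_ _ /(_ u v) /connectP[p pp pl]] := hG.
move: pl; have [p' pp' up' _ pl] := shortenP pp.
have : (size (u :: p') <= #|T|)%N.
  by rewrite -(card_uniqP up') max_card.
by apply: leq_trans => /=; rewrite ltnS; apply/gdist_le/has_walkP; exists p'.
Qed.

Lemma has_walk_gdist (u v : T) : has_walk adj u v (gdist adj u v).
Proof.
have lt := gdist_lt_card u v.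
have : has (has_walk adj u v) (iota 0 #|T|).
  by rewrite has_find size_iota.
by move/(nth_find 0); rewrite nth_iota.
Qed.

Lemma gdist_eq0 (u v : T) : gdist adj u v = 0%N -> u = v.
Proof.
move=> e; have := has_walk_gdist u v; rewrite e => /has_walkP[p [/size0nil -> _]].
by [].
Qed.

Lemma gdist_adj (y u v : T) :
  adj u v -> (gdist adj y v <= (gdist adj y u).+1)%N.
Proof.
move=> uv; have /has_walkP[p [sp pp pl]] := has_walk_gdist y u.
apply/gdist_le/has_walkP; exists (rcons p v).
by rewrite size_rcons sp rcons_path pp pl last_rcons.
Qed.

(** The witness is the penultimate vertex of a shortest walk from [y]. *)
Lemma gdist_pred (y u : T) (k : nat) : gdist adj y u = k.+1 ->
  exists2 v, adj v u & gdist adj y v = k.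
Proof.
move=> e; have := has_walk_gdist y u; rewrite e => /has_walkP[p []].
case/lastP: p => // p z; rewrite size_rcons rcons_path last_rcons.
case=> sp /andP[pp vz] zu; rewrite {z}zu in vz.
exists (last y p) => //; apply/eqP; rewrite eqn_leq; apply/andP; split.
  by apply/gdist_le/has_walkP; exists p.
by rewrite -ltnS -e gdist_adj.
Qed.

Lemma edgesP (a : {set T}) :
  reflect (exists u v, adj u v /\ a = [set u; v]%SET) (a \in edges adj).
Proof.
apply: (iffP imsetP) => [[[u v] /= uv ->]|[u [v [uv ->]]]]; first by exists u, v.
by exists (u, v).
Qed.

Lemma edge_distE (y u v : T) :
  edge_dist adj y [set u; v]%SET = minn (gdist adj y u) (gdist adj y v).
Proof.
rewrite /edge_dist -minEnat bigminU !bigmin_set1 minEnat.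
have := gdist_lt_card y u; have := gdist_lt_card y v; lia.
Qed.

(** A shortest walk from [y] to [u] moves away by one at each step, so its edges realize every
    smaller distance. *)
Lemma edge_dist_surj (y u : T) (i : nat) : (i < gdist adj y u)%N ->
  exists2 a, a \in edges adj & edge_dist adj y a = i.
Proof.
move: {2}(gdist adj y u) (erefl (gdist adj y u)) => k.
elim: k u => [|k IH] u e; rewrite e // ltnS leq_eqVlt => /orP[/eqP->|ik].
  have [v vu ev] := gdist_pred e; exists [set v; u]%SET.
    by apply/edgesP; exists v, u.
  by rewrite edge_distE e ev; apply/minn_idPl.
by have [v vu ev] := gdist_pred e; apply: (IH v) => //; rewrite ev.
Qed.

(** One edge is picked at each distance [i] below that of [a]; the picks are distinct since the
    distance of a pick recovers [i]. *)
Lemma edge_dist_le_card (y : T) (a : {set T}) : a \in edges adj ->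
  (edge_dist adj y a <=
   #|[set b in edges adj | (edge_dist adj y b < edge_dist adj y a)%N]%SET|)%N.
Proof.
move=> /edgesP[u [v [uv ->]]]; set k := edge_dist _ _ _.
rewrite -[leqLHS]card_ord.
pose D := [set b in edges adj | (edge_dist adj y b < k)%N]%SET.
have ex (i : 'I_k) : exists b, (b \in D) && (edge_dist adj y b == i).
  have [|b bE e] := @edge_dist_surj y u i.
    apply: leq_trans (ltn_ord i) _; rewrite /k edge_distE; exact: geq_minl.
  by exists b; rewrite inE bE e ltn_ord eqxx.
pose F (i : 'I_k) := xchoose (ex i).
have injF : injective F.
  move=> i j e; apply/val_inj => /=.
  have /andP[_ /eqP <-] := xchooseP (ex i).
  by have /andP[_ /eqP <-] := xchooseP (ex j); congr edge_dist.
rewrite -(card_imset _ injF); apply/subset_leq_card/fintype.subsetP => _ /imsetP[i _ ->].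
by have /andP[] := xchooseP (ex i).
Qed.

(* By [edge_dist_le_card] the left-hand side counts at most the pairs of edges
   at different distances (each unordered pair twice), plus the diagonal. *)
Lemma sum_edge_dist (y : T) :
  (\sum_(a in edges adj) (2 * edge_dist adj y a + 1) <= #|edges adj| ^ 2)%N.
Proof.
set E := edges adj; set h := edge_dist adj y.
have split1 : (\sum_(a in E) h a <= \sum_(a in E) \sum_(b in E) (h b < h a))%N.
  apply: leq_sum => a aE; apply: leq_trans (edge_dist_le_card y aE) _.
  rewrite -sum1_card big_mkcond [leqRHS]big_mkcond; apply: leq_sum => b _.
  by rewrite inE; case: (b \in E).
have split2 : (\sum_(a in E) h a <= \sum_(a in E) \sum_(b in E) (h a < h b))%N.
  by rewrite exchange_big.
have diag : #|E| = (\sum_(a in E) \sum_(b in E) (a == b))%N.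
  rewrite -sum1_card; apply: eq_bigr => a aE.
  rewrite (bigD1 a) //= eqxx big1 // => b /andP[_ /negPf]; by rewrite eq_sym => ->.
rewrite big_split /= sum1_card -big_distrr /= mul2n -addnn [leqRHS]expnS expn1.
apply: leq_trans (leq_add (leq_add split1 split2) (leqnn _)) _.
rewrite {1}diag -!big_split /= -sum_nat_const; apply: leq_sum => a aE.
rewrite -!big_split /= -sum1_card; apply: leq_sum => b bE.
case: (eqVneq a b) => [->|_]; first by rewrite ltnn.
by case: ltngtP.
Qed.

(** * Potentials grounded at [y] with at most a unit source at [x] *)

Section Potential.
Variables (R : realType) (g : T -> R) (x y : T).
Hypothesis g_y : g y = 0.
Hypothesis g_source : forall u,
  (deg adj u)%:R * g u <= (u == x)%:R + \sum_(v | adj u v) g v.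

(* The flow [g u - g v] has divergence at most one in total, and every edge
   leaving the superlevel set of [g a] carries a nonnegative flow. *)
Lemma potential_drop_le1 (a b : T) : adj a b -> g a <= g b + 1.
Proof.
move=> ab; case: (lerP (g a) (g b)) => [|gab]; first lra.
pose S := [pred u | g a <= g u].
have adjC : symmetric adj by have [] := hG.
have out : \sum_(u in S) \sum_(v | adj u v) (g u - g v) <= 1.
  apply: (@le_trans _ _ (\sum_(u in S) (u == x)%:R)).
    apply: ler_sum => u _; rewrite big_split /= sumrN sumr_const.
    have -> : #|adj u| = deg adj u by rewrite /deg cardsE.
    by rewrite -[_ *+ _]mulr_natl lerBlDr.
  under eq_bigr do rewrite mulrb.
  rewrite -big_mkcondr /=; case: (boolP (x \in S)) => xS.
    rewrite (bigD1 x) ?xS ?eqxx //= big1 ?addr0 // => u.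
    by case/andP => /andP[_ /eqP ->]; rewrite eqxx.
  by rewrite big1 // => u /andP[uS /eqP e]; rewrite e (negPf xS) in uS.
(* [I] collects the flow along edges with both ends in [S]; swapping the ends changes its sign, so
   it vanishes. *)
pose I := \sum_(u in S) \sum_(v in S | adj u v) (g u - g v).
have I0 : I = 0.
  have : I = - I; last by lra.
  rewrite {1}/I; under eq_bigr do rewrite big_mkcondr.
  rewrite exchange_big /= /I -sumrN; apply: eq_bigr => u uS.
  rewrite -big_mkcondr -sumrN /=.
  by apply: eq_big => [v|v _]; rewrite 1?adjC // opprB.
have : g a - g b <= 1; last by lra.
apply: le_trans out; rewrite (_ : \sum_(u in S) _ =
    I + \sum_(u in S) \sum_(v | adj u v && (v \notin S)) (g u - g v)); last first.
  rewrite -big_split /=; apply: eq_bigr => u _; rewrite (bigID (mem S)) /=.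
  by congr (_ + _); apply: eq_bigl => v; rewrite andbC.
have nn u v : u \in S -> v \notin S -> 0 <= g u - g v.
  by rewrite !inE -ltNge => h1 h2; rewrite subr_ge0 (le_trans (ltW h2)).
(* Only edges leaving [S] remain; the one from [a] to [b] is among them because [g b < g a]. *)
rewrite I0 add0r (bigD1 a) /=; last by rewrite inE.
rewrite (bigD1 b) /=; last by rewrite ab inE -ltNge.
rewrite -addrA lerDl addr_ge0 // sumr_ge0 //.
  by move=> v /andP[/andP[_ vS] _]; apply: nn; rewrite ?inE.
by move=> u /andP[uS _]; apply: sumr_ge0 => v /andP[_]; apply: nn.
Qed.

(** Along a shortest walk from [y], where [g] vanishes, each step raises [g] by at most one. *)
Lemma potential_le_gdist (a : T) : g a <= (gdist adj y a)%:R.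
Proof.
move: {2}(gdist adj y a) (erefl (gdist adj y a)) => k.
elim: k a => [|k IH] a e; rewrite e.
  by rewrite -(gdist_eq0 e) g_y.
have [v va ev] := gdist_pred e; have := IH _ ev; rewrite ev => gv.
have adjC : symmetric adj by have [] := hG.
have := @potential_drop_le1 a v; rewrite adjC => /(_ va) h.
by rewrite -natr1; apply: le_trans h _; rewrite lerD2r.
Qed.

End Potential.

(** Without loops, each edge comes from exactly two ordered pairs, one for each choice of first
    vertex. *)
Lemma sum_adj_edges (R : realType) (h : T -> R) (f : {set T} -> R) :
  \sum_u \sum_(v | adj u v) h u * f [set u; v]%SET =
  \sum_(a in edges adj) (\sum_(u in a) h u) * f a.
Proof.
rewrite pair_big_dep /=.
rewrite (partition_big (fun p : T * T => [set p.1; p.2]%SET) (mem (edges adj))) /=;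
  last by move=> [u v] /= uv; apply/edgesP; exists u, v.
apply: eq_bigr => _ /edgesP[a [b [ab ->]]].
have aNb : a != b.
  by apply: contraTneq ab => ->; have [_ -> _] := hG.
have adjC : symmetric adj by have [] := hG.
rewrite big_setU1 ?inE //= big_set1 mulrDl.
rewrite (bigD1 (a, b)) /=; last by rewrite ab eqxx.
rewrite (bigD1 (b, a)) /=; last first.
  by rewrite adjC ab finset.setUC eqxx xpair_eqE negb_and eq_sym aNb.
rewrite [[set b; a]%SET]finset.setUC big1 ?addr0 // => -[u v] /=.
rewrite !xpair_eqE => /andP[/andP[/andP[uv /eqP e] n1] n2]; exfalso.
have uNv : u != v.
  by apply: contraTneq uv => ->; have [_ -> _] := hG.
have : u \in [set a; b]%SET by rewrite -e !inE eqxx.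
have : v \in [set a; b]%SET by rewrite -e !inE eqxx orbT.
rewrite !inE => /orP[] /eqP ev /orP[] /eqP eu; move: n1 n2 uNv;
  by rewrite ev eu !eqxx.
Qed.

End GraphDistance.

Local Open Scope classical_set_scope.

(** * Events determined by a finite-valued random variable *)

Lemma probability_partition d (Omega : measurableType d) (R : realType)
    (P : probability Omega R) (I : finType) (Z : Omega -> I) (A : set Omega) :
  (forall i, measurable (Z @^-1` [set i])) -> measurable A ->
  (P A = \sum_i P (A `&` Z @^-1` [set i]))%E.
Proof.
move=> mZ mA; have e : A = \bigcup_(i in [set: I]) (A `&` Z @^-1` [set i]).
  by apply/seteqP; split=> [z Az|z [i _ []//]]; exists (Z z).
rewrite {1}e measure_fin_bigcup //; first last.
- by move=> i _; exact: measurableI.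
- by move=> i j _ _ [z [[_ /= <-] [_ /= <-]]].
- exact: finite_finset.
have -> : [set: I] = [set` index_enum I].
  by apply/seteqP; split=> i // _; exact: mem_index_enum.
by rewrite -fsbig_seq // index_enum_uniq.
Qed.

Lemma measurable_finite_preimage d (Omega : measurableType d) (I : finType)
    (Z : Omega -> I) (Q : set I) :
  (forall i, measurable (Z @^-1` [set i])) -> measurable (Z @^-1` Q).
Proof.
move=> mZ; have -> : Z @^-1` Q = \bigcup_(i in Q) (Z @^-1` [set i]).
  by apply/seteqP; split=> [z Qz|z [i Qi /= ->//]]; exists (Z z).
by apply: fin_bigcup_measurable => //; exact: finite_finset.
Qed.

(** * Occupation probabilities of the walk killed at [y] *)

Section KilledWalk.
Variables (R : realType) (T : finType) (adj : rel T).
Variables (d : measure_display) (Omega : measurableType d).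
Variables (P : probability Omega R) (X : nat -> Omega -> T) (x y : T).
Hypothesis hX : simple_random_walk adj P X x.

(** Packing the past into one variable with values in a finite type turns any event of the past into
    a finite disjoint union of histories. *)
Definition trajectory (n : nat) (o : Omega) : {ffun 'I_n.+1 -> T} :=
  [ffun i : 'I_n.+1 => X i o].

Lemma trajectory_fiber (n : nat) (w : {ffun 'I_n.+1 -> T}) :
  trajectory n @^-1` [set w] = history X (fun i => w (inord i)) n.
Proof.
apply/seteqP; split=> o /=.
  by move=> <- i lein; rewrite /trajectory ffunE inordK.
move=> h; apply/ffunP => i; rewrite ffunE h -1?ltnS //.
by rewrite inord_val.
Qed.

Lemma measurable_trajectory (n : nat) (w : {ffun 'I_n.+1 -> T}) :
  measurable (trajectory n @^-1` [set w]).
Proof.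
have [mX _ _] := hX; have -> : trajectory n @^-1` [set w] =
    \bigcap_(i in [set: 'I_n.+1]) (X i @^-1` [set w i]).
  apply/seteqP; split=> o /=; first by move=> <- i _ /=; rewrite ffunE.
  by move=> h; apply/ffunP => i; rewrite ffunE; exact: h.
by apply: fin_bigcap_measurable => //; exact: finite_finset.
Qed.

(** Summing the one-history property over the histories in [Q] works because they all end at [u] and
    so share the transition factor. *)
Lemma markov_property (n : nat) (Q : pred {ffun 'I_n.+1 -> T}) (u v : T) :
  (forall w, Q w -> w ord_max = u) ->
  (P (trajectory n @^-1` [set` Q] `&` X n.+1 @^-1` [set v]) =
   P (trajectory n @^-1` [set` Q]) * (step_prob R adj u v)%:E)%E.
Proof.
move=> Qu; have [mX _ mk] := hX; set A := trajectory n @^-1` _.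
have mtr := @measurable_trajectory n.
have mA : measurable A by exact: measurable_finite_preimage.
rewrite (probability_partition P mtr (measurableI _ _ mA (mX _ _))).
rewrite (probability_partition P mtr mA) ge0_sume_distrl //.
apply: eq_bigr => w _; rewrite setIAC.
have [Qw|Qw] := boolP (Q w); last first.
  have -> : A `&` trajectory n @^-1` [set w] = set0.
    apply/seteqP; split=> // o [/= Ao e]; case/negP: Qw; rewrite -e; exact: Ao.
  by rewrite set0I measure0 mul0e.
have -> : A `&` trajectory n @^-1` [set w] = trajectory n @^-1` [set w].
  by apply/setIidr => o /= e; rewrite /A /= e.
rewrite trajectory_fiber mk; congr (_ * (step_prob _ _ _ _)%:E)%E.
by rewrite -(Qu _ Qw); congr (w _); apply/val_inj; rewrite /= inordK.
Qed.

Definition alive_at (n : nat) (u : T) : set Omega :=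
  [set o | [forall k : 'I_n.+1, X k o != y] && (X n o == u)].

Lemma alive_atE (n : nat) (u : T) : alive_at n u = trajectory n @^-1`
  [set` [pred w : {ffun 'I_n.+1 -> T} |
          [forall k, w k != y] && (w ord_max == u)]].
Proof.
have alE o : ([forall k, trajectory n o k != y] && (trajectory n o ord_max == u)) =
    [forall k : 'I_n.+1, X k o != y] && (X n o == u).
  by rewrite ffunE; under eq_forallb do rewrite ffunE.
by apply/seteqP; split=> o; rewrite /alive_at /= -alE.
Qed.

Lemma measurable_alive_at (n : nat) (u : T) : measurable (alive_at n u).
Proof.
by rewrite alive_atE; apply: measurable_finite_preimage; exact: measurable_trajectory.
Qed.

Lemma alive_at_step (n : nat) (u v : T) :
  (P (alive_at n u `&` X n.+1 @^-1` [set v]) =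
   P (alive_at n u) * (step_prob R adj u v)%:E)%E.
Proof. by rewrite alive_atE (markov_property (u := u)) // => w /andP[_ /eqP]. Qed.

Definition alive_prob (n : nat) (u : T) : R := fine (P (alive_at n u)).

Lemma alive_probE (n : nat) (u : T) : P (alive_at n u) = (alive_prob n u)%:E.
Proof. by rewrite fineK // fin_num_measure //; exact: measurable_alive_at. Qed.

Lemma alive_prob_ge0 (n : nat) (u : T) : 0 <= alive_prob n u.
Proof. exact: fine_ge0. Qed.

Lemma alive_prob_target (n : nat) : alive_prob n y = 0.
Proof.
rewrite /alive_prob (_ : alive_at n y = set0) ?measure0 //.
apply/seteqP; split=> // o /andP[/forallP/(_ ord_max) /= /negP h] /eqP e.
by apply: h; rewrite e.
Qed.

Lemma alive_prob0 (u : T) : alive_prob 0 u <= (u == x)%:R.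
Proof.
have [mX hx _] := hX; rewrite -lee_fin -alive_probE.
have [->|ux] := eqVneq u x; first exact/probability_le1/measurable_alive_at.
have <- : P (~` (X 0 @^-1` [set x])) = 0%:E by rewrite probability_setC // hx subee.
apply: le_measure; rewrite ?inE.
- exact: measurable_alive_at.
- exact/measurableC.
- by move=> o /andP[_ /eqP /= e] e'; rewrite -e e' eqxx in ux.
Qed.

Hypothesis hG : connected_simple_graph adj.

Lemma deg_gt0 (u v : T) : u != v -> (0 < deg adj u)%N.
Proof.
move=> uv; have [_ _ /(_ u v)/connectP[[|w p] /= pp e]] := hG.
  by rewrite e eqxx in uv.
by rewrite /deg card_gt0; apply/set0Pn; exists w; rewrite inE; case/andP: pp.
Qed.

(** At [y] both sides vanish. Any other vertex has positive degree by connectedness, so the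
    absorbing case of [step_prob] does not arise there. *)
Lemma alive_prob_step_prob (n : nat) (u v : T) :
  alive_prob n u * step_prob R adj u v =
  if adj u v then alive_prob n u / (deg adj u)%:R else 0.
Proof.
have [->|uy] := eqVneq u y; first by rewrite alive_prob_target !mul0r if_same.
rewrite /step_prob -[_ == 0%N]negbK -lt0n (deg_gt0 uy) /=.
by case: ifP => _ //; rewrite mulr0.
Qed.

(** Split by the position at time [n]. Mass is lost only at [v = y], where the walk is killed. *)
Lemma alive_probS (n : nat) (v : T) :
  alive_prob n.+1 v <= \sum_(u | adj u v) alive_prob n u / (deg adj u)%:R.
Proof.
have [mX _ _] := hX; rewrite -lee_fin -alive_probE.
rewrite (probability_partition P (mX n) (measurable_alive_at n.+1 v)).
rewrite [in leRHS]big_mkcond /= -sumEFin; apply: lee_sum => u _.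
rewrite -alive_prob_step_prob EFinM -alive_probE -alive_at_step.
apply: le_measure; rewrite ?inE.
- exact: measurableI (measurable_alive_at _ _) (mX _ _).
- exact: measurableI (measurable_alive_at _ _) (mX _ _).
- move=> o [/andP[/forallP h /eqP e] /= eu]; split=> //=.
  apply/andP; split; last by rewrite eu.
  apply/forallP => k; exact: (h (widen_ord (leqnSn _) k)).
Qed.

(** The left-hand side is the truncated Green function of the killed walk divided by the degree; it
    satisfies the hypotheses on a potential. *)
Lemma alive_prob_sum_le (n : nat) (a : T) :
  (\sum_(k < n) alive_prob k a) / (deg adj a)%:R <= (gdist adj y a)%:R.
Proof.
pose g a := (\sum_(k < n) alive_prob k a) / (deg adj a)%:R.
have adjC : symmetric adj by have [] := hG.
have q0 k u : 0 <= alive_prob k u / (deg adj u)%:R.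
  by rewrite divr_ge0 // alive_prob_ge0.
rewrite -/(g a); apply: (@potential_le_gdist _ _ hG _ g x y) => [|u].
- by rewrite /g big1 ?mul0r // => k _; exact: alive_prob_target.
have gnn v : 0 <= g v by rewrite /g mulr_suml sumr_ge0.
have [->|du] := eqVneq (deg adj u) 0%N.
  by rewrite mul0r addr_ge0 // sumr_ge0.
rewrite /g mulrC divfK ?pnatr_eq0 //.
under [X in _ <= _ + X]eq_bigr do rewrite mulr_suml.
rewrite exchange_big /=; case: n => [|m] in g gnn *.
  by rewrite !big_ord0 addr0.
(* Time shifts by one: on the left, time [0] gives the source and time [k.+1] is bounded by the
   inflow from time [k]. The last time [m] on the right is a nonnegative surplus. *)
rewrite big_ord_recl /= big_ord_recr /= addrA.
apply: (@le_trans _ _ ((u == x)%:R +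
    \sum_(k < m) \sum_(v | adj u v) alive_prob k v / (deg adj v)%:R)).
  rewrite lerD ?alive_prob0 //; apply: ler_sum => k _.
  by under eq_bigl do rewrite adjC; exact: alive_probS.
by rewrite lerDl sumr_ge0.
Qed.

(** * Expected cost of the stopped walk *)

Variable f : {set T} -> R.
Hypothesis hf : forall a : {set T}, a \in edges adj -> 0 <= f a.

(** Extension by zero makes the cost nonnegative on all ordered pairs, whereas [f] is known to be so
    only on edges. *)
Let c (p : T * T) : R := if adj p.1 p.2 then f [set p.1; p.2]%SET else 0.

Let c_ge0 (p : T * T) : 0 <= c p.
Proof.
by rewrite /c; case: ifP => // h; apply/hf/edgesP; exists p.1, p.2.
Qed.

Let B (n : nat) (p : T * T) := alive_at n p.1 `&` X n.+1 @^-1` [set p.2].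

Let mB (n : nat) (p : T * T) : measurable (B n p).
Proof.
by have [mX _ _] := hX; apply: measurableI => //; exact: measurable_alive_at.
Qed.

Let step_cost (n : nat) (o : Omega) : \bar R :=
  (if [forall k : 'I_n.+1, X k o != y] && adj (X n o) (X n.+1 o)
      then f [set X n o; X n.+1 o]%SET else 0)%:E.

(** The events [B n p] are disjoint in [p], so a step cost is a finite combination of indicators
    that can be integrated term by term. *)
Let step_costE (n : nat) (o : Omega) :
  step_cost n o = (\sum_p (c p * \1_(B n p) o)%:E)%E.
Proof.
rewrite (bigD1 (X n o, X n.+1 o)) //= [X in (_ + X)%E]big1 ?adde0; last first.
  move=> [u v] ne; rewrite indicE memNset ?mulr0 // => -[/andP[_ /eqP e] /= e'].
  by rewrite e e' eqxx in ne.
rewrite /step_cost /c /= indicE.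
case: (boolP [forall k : 'I_n.+1, _]) => al /=.
  by rewrite mem_set ?mulr1 //; split=> //=; rewrite /alive_at /= al eqxx.
by rewrite memNset ?mulr0 // => -[/andP[al']]; rewrite al' in al.
Qed.

Let measurable_term (n : nat) (p : T * T) :
  measurable_fun setT (fun o => (c p * \1_(B n p) o)%:E).
Proof.
apply/measurable_EFinP; apply: measurable_funM => //; exact: measurable_indic.
Qed.

Lemma integral_step_cost (n : nat) : (\int[P]_o step_cost n o =
  (\sum_u \sum_(v | adj u v)
     alive_prob n u / (deg adj u)%:R * f [set u; v]%SET)%:E)%E.
Proof.
under eq_integral do rewrite step_costE.
rewrite ge0_integral_sum //; last first.
  by move=> p o _; rewrite lee_fin mulr_ge0.
rewrite pair_big_dep /= [in RHS]big_mkcond /= -sumEFin; apply: eq_bigr => -[u v] _.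
under eq_integral do rewrite EFinM.
rewrite ge0_integralZl_EFin //; last first.
  by apply/measurable_EFinP; exact: measurable_indic.
rewrite integral_indic // setIT /B /= alive_at_step alive_probE -!EFinM.
rewrite alive_prob_step_prob /c /=; case: ifP => _; last by rewrite mul0r.
by rewrite mulrC.
Qed.

Lemma hitting_cost_le : (hitting_cost adj P X f y
   <= (\sum_(a in edges adj) (2 * edge_dist adj y a + 1)%:R * f a)%:E)%E.
Proof.
have f0 n o : (0 <= step_cost n o)%E.
  rewrite step_costE; apply: sume_ge0 => p _.
  by rewrite lee_fin mulr_ge0.
have mf n : measurable_fun setT (step_cost n).
  by rewrite (funext (step_costE n)); exact: emeasurable_sum.
have -> : hitting_cost adj P X f y =
    (\int[P]_o \sum_(0 <= n <oo) step_cost n o)%E by [].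
rewrite (integral_nneseries P measurableT mf (fun n o _ => f0 n o)).
apply: lime_le; first by apply: is_cvg_nneseries => n _ _; exact: integral_ge0.
near=> N; rewrite big_mkord.
under eq_bigr do rewrite integral_step_cost.
rewrite sumEFin lee_fin exchange_big /=.
under eq_bigr => u _.
  rewrite exchange_big /=; under eq_bigr do rewrite -!mulr_suml.
  over.
rewrite (sum_adj_edges hG (fun u => (\sum_(k < N) alive_prob k u) / (deg adj u)%:R)).
apply: ler_sum => a aE; rewrite ler_wpM2r ?hf //.
move/edgesP: aE => [u [v [uv ->]]].
have uNv : u != v by apply: contraTneq uv => ->; have [_ -> _] := hG.
have vu : adj v u by have [adjC _ _] := hG; rewrite adjC.
rewrite big_setU1 ?inE //= big_set1.
apply: le_trans (lerD (alive_prob_sum_le N u) (alive_prob_sum_le N v)) _.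
(* The distances of adjacent vertices from [y] differ by at most one, so their sum is at most twice
   the smaller plus one. *)
rewrite -natrD ler_nat edge_distE //.
have := gdist_adj hG y uv; have := gdist_adj hG y vu; lia.
Unshelve. all: by end_near.
Qed.

End KilledWalk.

Theorem theorem7 (R : realType) (T : finType) (adj : rel T)
    (hG : connected_simple_graph adj)
    (f : {set T} -> R)
    (hf : forall a : {set T}, a \in edges adj -> 0 <= f a)
    (x y : T) :
  (forall (d : measure_display) (Omega : measurableType d)
      (P : probability Omega R) (X : nat -> Omega -> T),
    simple_random_walk adj P X x ->
    (hitting_cost adj P X f y
       <= (\sum_(a in edges adj) (2 * edge_dist adj y a + 1)%:R * f a)%:E)%E)
  /\ \sum_(a in edges adj) (2 * edge_dist adj y a + 1)%:R * f a
     <= (#|edges adj| ^ 2)%:R * \big[Num.max/0]_(a in edges adj) f a.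
Proof.
split=> [d Omega P X hX|]; first exact: (hitting_cost_le y hX hG hf).
set M := \big[Num.max/0]_(a in edges adj) f a.
apply: (@le_trans _ _ (\sum_(a in edges adj) (2 * edge_dist adj y a + 1)%:R * M)).
  by apply: ler_sum => a aE; rewrite ler_wpM2l //; exact: le_bigmax_cond.
rewrite -mulr_suml -natr_sum ler_wpM2r ?ler_nat ?sum_edge_dist //.
(* [M] is nonnegative because the maximum starts from [0]. *)
exact: bigmax_ge_id.
Qed.
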